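(* Let $n\ge 1$ and let $S=\operatorname{conv}(P_1,\ldots,P_{n+1})\subset\mathbb{R}^n$ be a nondegenerate $n$-simplex of volume $V$, let $G=\frac1{n+1}\sum_{i=1}^{n+1}P_i$ be its centroid, and let $C$ be the covariance matrix of the uniform probability distribution on $S$. For every interior point $M$ of $S$, the volumes $V_1(M),\ldots,V_{n+1}(M)$ of the $n+1$ facet-parallel corner simplexes of $S$ determined by $M$ satisfy \[ \sum_{i=1}^{n+1}\left(\frac{V_i(M)}{V}\right)^{2/n}=\frac1{n+1}+\frac1{(n+1)(n+2)}\,(M-G)^TC^{-1}(M-G). \]
   Context: Facet-parallel corner simplexes: let $\lambda_1,\ldots,\lambda_{n+1}>0$ be the barycentric coordinates of the interior point $M$ with respect to $P_1,\ldots,P_{n+1}$ (so $\sum_i\lambda_i=1$ and $M=\sum_i\lambda_iP_i$). The hyperplanes through $M$ parallel to the facets of $S$ determine $n+1$ small simplexes homothetic to $S$. The $i$-th one is $M+\lambda_i(S-P_i)$, i.e. the set of points of $S$ whose $j$-th barycentric coordinate is at least $\lambda_j$ for every $j\ne i$; it is the simplex with vertex $M$ bounded by the facet of $S$ opposite $P_i$ and by the hyperplanes through $M$ parallel to the other $n$ facets. It is a copy of $S$ with linear ratio $\lambda_i$. $V_i(M)$ denotes its $n$-dimensional volume. Covariance matrix: $C=\mathbb{E}\big[(X-G)(X-G)^T\big]=\frac1V\int_S (x-G)(x-G)^T\,dx$, where $X$ is uniformly distributed on $S$ (its mean is $G$). *)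

(* Defs.v *)
From HB Require Import structures.
From mathcomp Require Import all_boot all_order all_algebra.
From mathcomp Require Import all_classical all_reals all_analysis.
Set Implicit Arguments.
Unset Strict Implicit.
Unset Printing Implicit Defensive.
Import Order.TTheory GRing.Theory Num.Theory.
Import numFieldNormedType.Exports.
Local Open Scope classical_set_scope.
Local Open Scope ring_scope.

(* The library has no Lebesgue measure on R^n.  Column vectors get the
   sigma-algebra generated by the coordinates (that is, the Borel sets), and the
   measure is the iterated product of the Lebesgue measure on the line. *)

Definition coorv (R : realType) (n : nat) (i : 'I_n) (x : 'cV[R]_n) : R :=
  x i ord0.

Section measurable_colvec.
Context {R : realType}.
Variable n : nat.

Let colvec_set0 : g_sigma_preimage (@coorv R n) set0.
Proof. exact: sigma_algebra0. Qed.

Let colvec_setC A :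
  g_sigma_preimage (@coorv R n) A -> g_sigma_preimage (@coorv R n) (~` A).
Proof. exact: sigma_algebraC. Qed.

Let colvec_bigcup (F : (set 'cV[R]_n)^nat) :
  (forall i, g_sigma_preimage (@coorv R n) (F i)) ->
  g_sigma_preimage (@coorv R n) (\bigcup_i (F i)).
Proof. exact: sigma_algebra_bigcup. Qed.

HB.instance Definition _ :=
  @isMeasurable.Build default_measure_display
  'cV[R]_n (g_sigma_preimage (@coorv R n)) colvec_set0 colvec_setC
  colvec_bigcup.

End measurable_colvec.

Lemma measurable_coorv (R : realType) n (i : 'I_n) :
  measurable_fun [set: 'cV[R]_n] (coorv i).
Proof.
move=> _ Y mY; rewrite setTI; apply: sub_sigma_algebra => /=.
rewrite -bigcup_seq/=; exists i => /=; first by rewrite mem_index_enum.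
by exists Y => //; rewrite setTI.
Qed.

Lemma measurable_colvecP (R : realType) d (T : measurableType d) n
    (f : T -> 'cV[R]_n) :
  (forall i, measurable_fun [set: T] (coorv i \o f)) ->
  measurable_fun [set: T] f.
Proof.
move=> mf; suff h : g_sigma_preimage (fun i => @coorv R n i \o f) `<=` measurable.
  by move: h; rewrite g_sigma_preimage_comp => h _ A mA; apply: h; exists A.
apply: smallest_sub; first exact: sigma_algebra_measurable.
move=> A; rewrite -bigcup_seq => -[i _ [B mB <-]]; exact: mf.
Qed.

Definition consv (R : realType) (n : nat) (p : R * 'cV[R]_n) : 'cV[R]_n.+1 :=
  \col_i if unlift ord0 i is Some j then p.2 j ord0 else p.1.

Lemma coorv_consv0 (R : realType) n (p : R * 'cV[R]_n) :
  coorv ord0 (consv p) = p.1.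
Proof. by rewrite /coorv mxE unlift_none. Qed.

Lemma coorv_consvS (R : realType) n (p : R * 'cV[R]_n) j :
  coorv (lift ord0 j) (consv p) = coorv j p.2.
Proof. by rewrite /coorv mxE liftK. Qed.

Lemma measurable_consv (R : realType) n :
  measurable_fun setT (@consv R n).
Proof.
apply: measurable_colvecP => i; case: (unliftP ord0 i) => [j ->|->].
  rewrite (_ : _ \o _ = coorv j \o snd); last first.
    by apply/funext => p /=; rewrite coorv_consvS.
  exact: measurableT_comp (measurable_coorv _) measurable_snd.
rewrite (_ : _ \o _ = fst); last by apply/funext => p /=; rewrite coorv_consv0.
exact: measurable_fst.
Qed.

Fixpoint lebesgue_colvec (R : realType) (n : nat) : set 'cV[R]_n -> \bar R :=
  match n return set 'cV[R]_n -> \bar R with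
  | 0 => dirac (0 : 'cV[R]_0)
  | n'.+1 => pushforward (lebesgue_measure \x @lebesgue_colvec R n')%E
               (@consv R n')
  end.

Definition unconsv (R : realType) (n : nat) (x : 'cV[R]_n.+1) : R * 'cV[R]_n :=
  (x ord0 ord0, \col_j x (lift ord0 j) ord0).

Lemma consvK (R : realType) n : cancel (@consv R n) (@unconsv R n).
Proof.
case=> a v; rewrite /unconsv mxE unlift_none; congr pair.
by apply/colP => j; rewrite !mxE liftK.
Qed.

Lemma unconsvK (R : realType) n : cancel (@unconsv R n) (@consv R n).
Proof.
move=> x; apply/colP => i; rewrite mxE.
by case: (unliftP ord0 i) => [j ->|->] //=; rewrite mxE.
Qed.

Lemma measurable_unconsv (R : realType) n :
  measurable_fun setT (@unconsv R n).
Proof.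
apply: measurable_fun_pair; first exact: (@measurable_coorv R n.+1 ord0).
apply: measurable_colvecP => j.
rewrite (_ : _ \o _ = coorv (lift ord0 j)); first exact: measurable_coorv.
by apply/funext => x; rewrite /coorv /= mxE.
Qed.

Lemma product_sigma_finite d1 d2 (T1 : measurableType d1)
    (T2 : measurableType d2) (R : realType)
    (m1 : {sigma_finite_measure set T1 -> \bar R})
    (m2 : {sigma_finite_measure set T2 -> \bar R}) :
  sigma_finite setT (m1 \x m2)%E.
Proof.
have /sigma_finiteP[F [TF ndF Foo]] := sigma_finiteT m1.
have /sigma_finiteP[G [TG ndG Goo]] := sigma_finiteT m2.
exists (fun n => F n `*` G n).
  rewrite -setXTT TF TG predeqE => -[x y]; split.
    move=> [/= [n _ Fnx] [k _ Gky]]; exists (maxn n k) => //; split.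
    - by move: x Fnx; exact/subsetPset/ndF/leq_maxl.
    - by move: y Gky; exact/subsetPset/ndG/leq_maxr.
  by move=> [n _ []/= ? ?]; split; exists n.
move=> k; have [? ?] := Foo k; have [? ?] := Goo k.
split; first exact: measurableX.
by rewrite product_measure1E// lte_mul_pinfty// ge0_fin_numE.
Qed.

Section pushforward_consv.
Variables (R : realType) (n : nat).
Variable mu : {sigma_finite_measure set 'cV[R]_n -> \bar R}.

Let nu : {measure set (measurableTypeR R * 'cV[R]_n)%type -> \bar R} :=
  (@lebesgue_measure R \x mu)%E.

Let m : set 'cV[R]_n.+1 -> \bar R := pushforward nu (@consv R n).

Let mpre A : measurable A -> measurable (@consv R n @^-1` A).
Proof.
by move=> mA; rewrite -[X in measurable X]setTI; exact: measurable_consv.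
Qed.

Let m0 : m set0 = 0%E.
Proof. by rewrite /m /pushforward preimage_set0 (measure0 nu). Qed.

Let m_ge0 A : (0 <= m A)%E.
Proof. exact: (measure_ge0 nu). Qed.

Let m_sigma_additive : semi_sigma_additive m.
Proof.
move=> F mF tF mUF; rewrite /m /pushforward preimage_bigcup.
apply: (@measure_semi_sigma_additive _ _ _ nu).
- by move=> k; exact: mpre.
- apply/trivIsetP => /= i j _ _ ij; rewrite -preimage_setI.
  by move/trivIsetP : tF => /(_ _ _ _ _ ij) ->//; rewrite preimage_set0.
- by rewrite -preimage_bigcup; exact: mpre.
Qed.

HB.instance Definition _ :=
  isMeasure.Build _ _ _ m m0 m_ge0 m_sigma_additive.

Let m_sigma_finite : sigma_finite setT m.
Proof.
have [F FT mF] := product_sigma_finite (@lebesgue_measure R) mu.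
exists (fun k => @unconsv R n @^-1` F k).
  by rewrite -preimage_bigcup -FT.
move=> k; have [mFk nuFk] := mF k; split.
  by rewrite -[X in measurable X]setTI; exact: measurable_unconsv.
rewrite /m /pushforward -comp_preimage.
by rewrite (_ : _ \o _ = id) // funeqE => x /=; rewrite consvK.
Qed.

HB.instance Definition _ :=
  Measure_isSigmaFinite.Build _ _ _ m m_sigma_finite.

Lemma pushforward_consv_sigma_finite :
  exists mu' : {sigma_finite_measure set 'cV[R]_n.+1 -> \bar R},
    pushforward (@lebesgue_measure R \x mu)%E (@consv R n) = mu'.
Proof. by exists m. Qed.

End pushforward_consv.

Section lebesgue_colvec_measure.
Variables (R : realType) (n : nat).

Lemma lebesgue_colvec_sigma_finite_measure :
  exists mu : {sigma_finite_measure set 'cV[R]_n -> \bar R},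
    @lebesgue_colvec R n = mu.
Proof.
elim: n => [|k [mu /= ->]]; first by exists (dirac (0 : 'cV[R]_0)).
exact: pushforward_consv_sigma_finite.
Qed.

Let lebesgue_colvec0 : @lebesgue_colvec R n set0 = 0%E.
Proof. by have [mu ->] := lebesgue_colvec_sigma_finite_measure. Qed.

Let lebesgue_colvec_ge0 A : (0 <= @lebesgue_colvec R n A)%E.
Proof. by have [mu ->] := lebesgue_colvec_sigma_finite_measure. Qed.

Let lebesgue_colvec_sigma_additive : semi_sigma_additive (@lebesgue_colvec R n).
Proof.
have [mu ->] := lebesgue_colvec_sigma_finite_measure.
exact: measure_semi_sigma_additive.
Qed.

HB.instance Definition _ := isMeasure.Build _ _ _ (@lebesgue_colvec R n)
  lebesgue_colvec0 lebesgue_colvec_ge0 lebesgue_colvec_sigma_additive.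

Let lebesgue_colvec_sigma_finite : sigma_finite setT (@lebesgue_colvec R n).
Proof.
have [mu ->] := lebesgue_colvec_sigma_finite_measure.
exact: sigma_finiteT.
Qed.

HB.instance Definition _ := Measure_isSigmaFinite.Build _ _ _
  (@lebesgue_colvec R n) lebesgue_colvec_sigma_finite.

End lebesgue_colvec_measure.

Section simplexes.
Variables (R : realType) (n : nat).
Implicit Types (P : 'I_n.+1 -> 'cV[R]_n) (x M : 'cV[R]_n).

Definition affinely_independent P :=
  forall c : 'I_n.+1 -> R,
    \sum_i c i = 0 -> \sum_i c i *: P i = 0 -> forall i, c i = 0.

Definition simplex P : set 'cV[R]_n :=
  [set x | exists l : 'I_n.+1 -> R,
    [/\ forall i, 0 <= l i, \sum_i l i = 1 & x = \sum_i l i *: P i]].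

Definition is_barycentric P x (l : 'I_n.+1 -> R) :=
  \sum_i l i = 1 /\ x = \sum_i l i *: P i.

(* For affinely independent P these coordinates exist and are unique; the
   default value of xget is then never used. *)
Definition barycentric P x : 'I_n.+1 -> R :=
  xget (fun=> 0) [set l | is_barycentric P x l].

(* M + lambda_i (S - P_i), with lambda_i the i-th barycentric coordinate of M.
   This is the simplex cut out by the facet opposite P_i and the hyperplanes
   through M parallel to the other facets. *)
Definition corner_simplex P M (i : 'I_n.+1) : set 'cV[R]_n :=
  [set M + barycentric P M i *: (x - P i) | x in simplex P].

Definition volume (A : set 'cV[R]_n) : R := fine (lebesgue_colvec A).

Definition centroid P : 'cV[R]_n := n.+1%:R^-1 *: \sum_i P i.

(* The mean of the uniform distribution on the simplex is the centroid. *)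
Definition covariance_mx P : 'M[R]_n :=
  \matrix_(j, k) ((volume (simplex P))^-1 *
    \int[@lebesgue_colvec R n]_(x in simplex P)
      ((x - centroid P) *m (x - centroid P)^T) j k).

End simplexes.

(* Main.v *)
(* The i-th corner simplex is homothetic to S with ratio lambda_i, so the left
   side is the sum of the lambda_i ^ 2.  If D has columns P_i - G, then
   M - G = D w with w_i = lambda_i - 1 / (n + 1), and the moments
   E[lambda_a lambda_b] = (1 + [a = b]) / ((n + 1) (n + 2)) give
   C = D D^T / ((n + 1) (n + 2)), so that the quadratic form is
   (n + 1) (n + 2) |w|^2.  The moments need neither determinants nor iterated
   integrals: a linear bijection multiplies volumes by some constant (uniqueness
   of translation invariant measures), so the normalized moments are the same
   for all simplexes, and cutting S in two through the midpoint of an edge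
   yields a linear relation which determines them. *)
Require Import Defs.
From HB Require Import structures.
From mathcomp Require Import all_boot all_order all_algebra.
From mathcomp Require Import fingroup perm.
From mathcomp Require Import all_classical all_reals all_analysis.
From mathcomp Require Import measurable_realfun ring lra.
Set Implicit Arguments.
Unset Strict Implicit.
Unset Printing Implicit Defensive.
Import Order.TTheory GRing.Theory Num.Theory.
Import numFieldNormedType.Exports.
Local Open Scope classical_set_scope.
Local Open Scope ring_scope.

(** * Lebesgue measure and linear maps *)

Section measurability.
Variables (R : realType) (d : measure_display) (T : measurableType d).

Lemma measurable_preimage (d' : measure_display) (T' : measurableType d')
    (f : T -> T') (A : set T') :
  measurable_fun setT f -> measurable A -> measurable (f @^-1` A).
Proof. by move=> mf mA; rewrite -[X in measurable X]setTI; exact: mf. Qed.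

Lemma measurable_addv n (f g : T -> 'cV[R]_n) :
  measurable_fun setT f -> measurable_fun setT g ->
  measurable_fun setT (fun x => f x + g x).
Proof.
move=> mf mg; apply: measurable_colvecP => i.
rewrite (_ : _ \o _ = (coorv i \o f) \+ (coorv i \o g)); last first.
  by apply/funext => x; rewrite /coorv /= mxE.
by apply: measurable_funD; apply: measurableT_comp => //; exact: measurable_coorv.
Qed.

Lemma measurable_mulmxv m n (A : 'M[R]_(m, n)) (f : T -> 'cV[R]_n) :
  measurable_fun setT f -> measurable_fun setT (fun x => A *m f x).
Proof.
move=> mf; apply: measurable_colvecP => i.
rewrite (_ : _ \o _ = fun x => \sum_j A i j * coorv j (f x)); last first.
  by apply/funext => x; rewrite /coorv /= mxE.
apply: measurable_sum => j; apply: measurable_funM => //.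
by apply: measurableT_comp => //; exact: measurable_coorv.
Qed.

End measurability.

(* [pushforward m f] is not recognized as a measure by unification here. *)
Definition pushforward_measure (R : realType) (d d' : measure_display)
    (T : measurableType d) (T' : measurableType d')
    (m : {measure set T -> \bar R}) (f : T -> T') (mf : measurable_fun setT f) :
  {measure set T' -> \bar R} :=
  measure_function_pushforward__canonical__measure_function_Measure m mf.

(** * Translation invariance and cubes *)

Section translation_and_boxes.
Variable R : realType.
Local Notation leb := (@lebesgue_measure R).
Local Notation mu n := (@lebesgue_colvec R n).

Lemma lebesgue_measure_translate (a : R) (A : set (measurableTypeR R)) :
  measurable A -> leb ((fun x => x + a) @^-1` A) = leb A.
Proof.
move=> mA.
have mf : measurable_fun setT (fun x : measurableTypeR R => x + a : measurableTypeR R).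
  exact: measurable_funD.
symmetry; apply: (lebesgue_measure_unique (mu := pushforward_measure leb mf)) => // _ [[b c]] _ <-.
rewrite /pushforward_measure /= /pushforward (_ : _ @^-1` _ = `]b - a, c - a]%classic); last first.
  by apply/seteqP; split => x /=; rewrite !in_itv /= ltrBlDr lerBrDr.
rewrite !lebesgue_measure_itv /= !lte_fin ltrD2r -!EFinD.
by rewrite (_ : c - a - (b - a) = c - b) //; ring.
Qed.

Lemma lebesgue_colvecS n (A : set 'cV[R]_n.+1) :
  mu n.+1 A = (leb \x mu n)%E (@consv R n @^-1` A).
Proof. by []. Qed.

(** Induction on [n]: through [consv] a translation acts separately on the first entry and on the
    rest, so the two measures agree on rectangles, and uniqueness of the product measure extends
    this to all measurable sets. *)
Lemma lebesgue_colvec_translate n (v : 'cV[R]_n) (A : set 'cV[R]_n) :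
  measurable A -> mu n ((fun x => x + v) @^-1` A) = mu n A.
Proof.
elim: n v A => [v A mA|n IH v A mA].
  by congr (lebesgue_colvec _); apply/seteqP; split => x /=; rewrite !flatmx0.
rewrite !lebesgue_colvecS.
pose f (p : measurableTypeR R * 'cV[R]_n) : measurableTypeR R * 'cV[R]_n :=
  (p.1 + (unconsv v).1, p.2 + (unconsv v).2).
have mf : measurable_fun setT f.
  apply: measurable_fun_pair; first exact: measurable_funD.
  exact: measurable_addv.
have fE : (fun x => x + v) \o @consv R n = @consv R n \o f.
  apply/funext => -[b x]; apply/colP => i; rewrite /f /= !mxE.
  by case: unliftP => [j|] -> //=; rewrite !mxE.
transitivity (pushforward (leb \x mu n)%E f (@consv R n @^-1` A)).
  change ((leb \x mu n)%E (((fun x => x + v) \o @consv R n) @^-1` A) =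
    (leb \x mu n)%E ((@consv R n \o f) @^-1` A)).
  by rewrite fE.
have := @product_measure_unique _ _ _ _ _ leb (mu n) (pushforward_measure (leb \x mu n)%E mf).
move=> H; symmetry; apply: H => [B C mB mC|].
  rewrite /= /pushforward_measure /= /pushforward.
  rewrite (_ : _ @^-1` _ = ((fun x => x + (unconsv v).1) @^-1` B) `*`
    ((fun x => x + (unconsv v).2) @^-1` C)); last by apply/seteqP; split => -[].
  rewrite product_measure1E; last 2 first.
  - by apply: measurable_preimage => //; exact: measurable_funD.
  - by apply: measurable_preimage => //; exact: measurable_addv.
  by congr (_ * _)%E; [exact: lebesgue_measure_translate|exact: IH].
exact: measurable_preimage (@measurable_consv R n) mA.
Qed.

(** The test sets of known volume: they fix scaling constants, bound simplexes from outside and from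
    inside, and shrink to a point for [r = 0]. *)
Definition cube n (r : R) : set 'cV[R]_n := [set x | forall i, 0 <= x i ord0 <= r].

Lemma measurable_cube n r : measurable (@cube n r).
Proof.
rewrite (_ : cube r = \bigcap_(i in [set: 'I_n]) (@coorv R n i @^-1` `[0, r]%classic)).
  apply: fin_bigcap_measurable => [|i _]; [exact: finite_finset|apply: measurable_preimage => //].
  exact: measurable_coorv.
by apply/seteqP; split => x /= cx i; have := cx i; rewrite /= in_itv //=; exact.
Qed.

Lemma lebesgue_colvec_cube n (r : R) : 0 <= r -> mu n (cube r) = (r ^+ n)%:E.
Proof.
move=> r0; elim: n => [|n IH].
  rewrite /= (_ : cube r = setT) ?diracT //.
  by apply/seteqP; split => // x _ [].
rewrite lebesgue_colvecS (_ : _ @^-1` _ = `[0, r]%classic `*` @cube n r); last first.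
  apply/seteqP; split => -[a x] /=.
    move=> h; split; first by have := h ord0; rewrite !mxE unlift_none in_itv.
    by move=> i; have := h (lift ord0 i); rewrite !mxE liftK.
  rewrite in_itv /= => -[ha hx] i; rewrite !mxE.
  by case: unliftP => [j|] _ //=; exact: hx.
rewrite product_measure1E //; last exact: measurable_cube.
transitivity (leb `[0%R, r]%classic * (r ^+ n)%:E)%E; first by congr (_ * _)%E; exact: IH.
(* The interval formula distinguishes whether [0 < r]. Otherwise [r = 0], and both sides vanish
   because the exponent is [n.+1]. *)
rewrite lebesgue_measure_itv /= lte_fin; have [r1|] := ltP 0 r; first by rewrite -!EFinD subr0 -EFinM exprS.
by move=> r2; rewrite mul0e exprS (le_anti (introT andP (conj r2 r0))) mul0r.
Qed.

End translation_and_boxes.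

(** Tonelli for the indicator of [E]. *)
Lemma measure_slices_swap (R : realType) (d1 d2 : measure_display)
    (T1 : measurableType d1) (T2 : measurableType d2)
    (m1 : {sigma_finite_measure set T1 -> \bar R})
    (m2 : {sigma_finite_measure set T2 -> \bar R}) (E : set (T1 * T2)) :
  measurable E ->
  (\int[m1]_x m2 [set y | E (x, y)] = \int[m2]_y m1 [set x | E (x, y)])%E.
Proof.
move=> mE; have mf : measurable_fun setT (fun z => (\1_E z)%:E : \bar R).
  by apply/measurable_EFinP; exact: measurable_indic.
have slice (d : measure_display) (T : measurableType d)
    (m : {measure set T -> \bar R}) (F : set T) :
    measurable F -> (m F = \int[m]_x (\1_F x)%:E)%E.
  by move=> mF; rewrite integral_indic // setIT.
transitivity (\int[m1]_x \int[m2]_y (\1_E (x, y))%:E)%E.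
  apply: eq_integral => x _; rewrite slice; last first.
    have := measurable_xsection x mE; rewrite /xsection.
    by under eq_set do rewrite inE.
  apply: eq_integral => y _; rewrite !indicE.
  suff -> : ((x, y) \in E) = (y \in [set y | E (x, y)]) by [].
  by apply/idP/idP; rewrite !inE.
rewrite (fubini_tonelli (fun z => (\1_E z)%:E)) //.
apply: eq_integral => y _; rewrite slice; last first.
  have := measurable_ysection y mE; rewrite /ysection.
  by under eq_set do rewrite inE.
apply: eq_integral => x _; rewrite !indicE.
suff -> : ((x, y) \in E) = (x \in [set x | E (x, y)]) by [].
by apply/idP/idP; rewrite !inE.
Qed.

(** * Linear bijections multiply volume by a constant *)

Section linear_change_of_variables.
Variables (R : realType) (n : nat).
Local Notation mu := (@lebesgue_colvec R n).
Local Open Scope ereal_scope.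

Lemma integral_slices (D : set 'cV[R]_n) (F : 'cV[R]_n -> set 'cV[R]_n) c :
  measurable D -> (forall x, D x -> mu (F x) = c) ->
  \int[mu]_x mu [set y | D x /\ F x y] = c * mu D.
Proof.
move=> mD FE; rewrite -integral_cst // [RHS]integral_mkcond.
apply: eq_integral => x _; rewrite patchE; case: ifPn => [/set_mem Dx|/negP Dx].
  by rewrite /= -(FE x Dx); congr (lebesgue_colvec _); apply/seteqP; split => y //= [].
rewrite (_ : [set y | _] = set0) ?measure0 //.
by apply/seteqP; split => y //= -[/mem_set].
Qed.

(* Translating [y] by [T x], exchanging the integrals, translating [x] by
   [T^-1 y] and exchanging again turns one side into the other. *)
Lemma lebesgue_colvec_preimage_mulmx_swap (T : 'M[R]_n) (A B : set 'cV[R]_n) :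
  T \in unitmx -> measurable A -> measurable B ->
  mu ((fun x => T *m x)%R @^-1` A) * mu B =
  mu A * mu ((fun x => - T *m x)%R @^-1` B).
Proof.
move=> uT mA mB.
pose E := [set z : 'cV[R]_n * 'cV[R]_n | A (T *m z.1)%R /\ B (z.2 - T *m z.1)%R].
pose E' := [set z : 'cV[R]_n * 'cV[R]_n | B (- T *m z.1)%R /\ A (z.2 + T *m z.1)%R].
have mfst : measurable_fun setT (@fst 'cV[R]_n 'cV[R]_n) by exact: measurable_fst.
have msnd : measurable_fun setT (@snd 'cV[R]_n 'cV[R]_n) by exact: measurable_snd.
have mid : measurable_fun setT (@id 'cV[R]_n) by exact: measurable_id.
have mE : measurable E.
  apply: measurableI; apply: measurable_preimage => //; first exact: measurable_mulmxv.
  under eq_fun do rewrite -mulNmx.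
  by apply: measurable_addv => //; exact: measurable_mulmxv.
have mE' : measurable E'.
  apply: measurableI; apply: measurable_preimage => //; first exact: measurable_mulmxv.
  by apply: measurable_addv => //; exact: measurable_mulmxv.
transitivity (\int[mu]_x mu [set y | E (x, y)]).
  rewrite muleC; symmetry.
  apply: (@integral_slices (fun x => A (T *m x)%R) (fun x y => B (y - T *m x)%R)) => [|x _].
    by apply: measurable_preimage => //; exact: measurable_mulmxv.
  exact: lebesgue_colvec_translate.
rewrite measure_slices_swap //.
transitivity (\int[mu]_y mu [set x | E' (x, y)]).
  apply: eq_integral => y _.
  have mEy : measurable [set x | E (x, y)].
    have := measurable_ysection y mE; rewrite /ysection.
    by under eq_set do rewrite inE.
  rewrite -[LHS](lebesgue_colvec_translate (invmx T *m y) mEy).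
  congr (lebesgue_colvec _); apply/seteqP; split => x /=; rewrite /E /E' /=.
    by rewrite mulmxDr mulKVmx // opprD addrCA subrr addr0 mulNmx addrC => -[].
  by rewrite mulmxDr mulKVmx // opprD addrCA subrr addr0 mulNmx addrC => -[].
rewrite -measure_slices_swap //.
apply: (@integral_slices (fun x => B (- T *m x)%R) (fun x y => A (y + T *m x)%R)) => [|x _].
  by apply: measurable_preimage => //; exact: measurable_mulmxv.
exact: lebesgue_colvec_translate.
Qed.

(** With the unit cube as [B], the exchange identity gives the factor explicitly: [c T] is the
    measure of the preimage of the cube under [- T]. It is only known to lie in [0, +oo] at
    first. *)
Lemma lebesgue_colvec_preimage_mulmx (T : 'M[R]_n) : T \in unitmx ->
  exists2 c : R, (0 < c)%R & forall A, measurable A ->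
    mu ((fun x => T *m x)%R @^-1` A) = c%:E * mu A.
Proof.
move=> uT; pose c (U : 'M[R]_n) := mu ((fun x => - U *m x)%R @^-1` cube 1).
have cube1 : mu (cube 1) = 1 by rewrite lebesgue_colvec_cube // expr1n.
have cE (U : 'M[R]_n) (A : set 'cV[R]_n) : U \in unitmx -> measurable A ->
    mu ((fun x => U *m x)%R @^-1` A) = c U * mu A.
  move=> uU mA; rewrite muleC -lebesgue_colvec_preimage_mulmx_swap //.
    by rewrite cube1 mule1.
  exact: measurable_cube.
have uT' : invmx T \in unitmx by rewrite unitmx_inv.
(* Taking preimages of the cube under [T] and its inverse in turn gives the cube back. A product
   equal to 1 excludes both 0 and +oo as values of [c T]. *)
have c1 : c T * c (invmx T) = 1.
  rewrite -[c (invmx T)]mule1 -cube1 -cE //; last exact: measurable_cube.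
  rewrite -cE //; last first.
    apply: measurable_preimage; last exact: measurable_cube.
    by apply: measurable_mulmxv; exact: measurable_id.
  rewrite -comp_preimage (_ : _ \o _ = id) ?cube1 //.
  by apply/funext => x /=; rewrite mulKmx.
have cge0 U : 0 <= c U by exact: measure_ge0.
have cT0 : c T != 0.
  by apply/eqP => c0; move: c1; rewrite c0 mul0e => /esym/eqP; rewrite onee_eq0.
have cTfin : c T \is a fin_num.
  rewrite ge0_fin_numE // ltey; apply/eqP => cy; move: c1; rewrite cy.
  have := cge0 (invmx T); rewrite le_eqVlt => /predU1P[<-|c0].
    by rewrite mule0 => /esym/eqP; rewrite onee_eq0.
  by rewrite gt0_mulye.
exists (fine (c T)); first by rewrite fine_gt0 // -ge0_fin_numE // cTfin andbT lt0e cT0 cge0.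
by move=> A mA; rewrite fineK // cE.
Qed.

Lemma lebesgue_colvec_scale (r : R) (A : set 'cV[R]_n) : (0 < r)%R -> measurable A ->
  mu A = (r ^+ n)%:E * mu ((fun x => r *: x)%R @^-1` A).
Proof.
move=> r0 mA; have rn0 : (r != 0)%R by rewrite gt_eqF.
have mr : measurable ((fun x : 'cV[R]_n => r *: x)%R @^-1` A).
  under eq_fun do rewrite -mul_scalar_mx.
  by apply: measurable_preimage => //; apply: measurable_mulmxv; exact: measurable_id.
have [c c0 cE] : exists2 c : R, (0 < c)%R & forall A, measurable A ->
    mu ((fun x => r^-1%:M *m x)%R @^-1` A) = c%:E * mu A.
  apply: lebesgue_colvec_preimage_mulmx.
  by rewrite unitmxE det_scalar unitrX // unitfE invr_eq0.
(* The constant is read off the unit cube, whose preimage under division by [r] is the cube of side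
   [r]. *)
have -> : (r ^+ n)%:E = c%:E.
  have := cE _ (@measurable_cube R n 1).
  rewrite lebesgue_colvec_cube // expr1n mule1 => <-.
  rewrite -lebesgue_colvec_cube ?ltW //; congr (lebesgue_colvec _).
  apply/seteqP; split => x /= h i; have := h i; rewrite mul_scalar_mx mxE.
    by rewrite pmulr_rge0 ?invr_gt0 // mulrC ler_pdivrMr // mul1r.
  by rewrite pmulr_rge0 ?invr_gt0 // mulrC ler_pdivrMr // mul1r.
rewrite -cE //; congr (lebesgue_colvec _); apply/seteqP.
by split => x /=; rewrite mul_scalar_mx scalerA divff // scale1r.
Qed.

End linear_change_of_variables.

(* The graph of [l] is null since its sections over [x] are points, and its
   sections over [t] are translates of [l = 0]. *)
Lemma lebesgue_colvec_level0 (R : realType) n (l : 'cV[R]_n -> R) (v : 'cV[R]_n) :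
  measurable_fun setT l -> (forall x t, l (x + t *: v) = l x + t) ->
  lebesgue_colvec [set x | l x = 0] = 0%E.
Proof.
move=> ml lv; set c := lebesgue_colvec _.
have ml0 : measurable [set x | l x = 0].
  rewrite (_ : [set x | _] = l @^-1` [set 0]) //.
  by apply: measurable_preimage => //; exact: measurable_set1.
pose E := [set z : 'cV[R]_n * measurableTypeR R | l z.1 = z.2].
have mE : measurable E.
  rewrite (_ : E = (fun z : 'cV[R]_n * measurableTypeR R => l z.1 - z.2) @^-1` [set 0]).
    apply: measurable_preimage; last exact: measurable_set1.
    apply: measurable_funB; last exact: measurable_snd.
    exact: measurableT_comp ml measurable_fst.
  by apply/seteqP; split => z /= => [->|/subr0_eq] //; rewrite subrr.
have := measure_slices_swap (@lebesgue_colvec R n) (@lebesgue_measure R) mE.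
rewrite integral0_eq => [|x _]; last first.
  rewrite (_ : [set y | _] = [set l x]); first exact: lebesgue_measure_set1.
  by apply/seteqP; split => y /= ->.
rewrite (eq_integral (cst c)) => [|t _]; last first.
  rewrite /= /c -(lebesgue_colvec_translate (- t *: v) ml0).
  congr (lebesgue_colvec _); apply/seteqP; split => x; rewrite /E /= lv => h.
    by rewrite h subrr.
  exact: subr0_eq.
have leboo : lebesgue_measure [set: measurableTypeR R] = +oo%E.
  by rewrite -set_itvNyy lebesgue_measure_itv.
rewrite integral_cst // => h; have {}h : (0 = c * +oo)%E by rewrite -leboo.
have : (0 <= c)%E by exact: measure_ge0.
rewrite le_eqVlt => /predU1P[<- //|c0].
by move: h; rewrite gt0_muley.
Qed.

Lemma unitmx_inj (F : fieldType) n (A : 'M[F]_n) :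
  (forall x : 'cV_n, A *m x = 0 -> x = 0) -> A \in unitmx.
Proof.
move=> Ainj; rewrite -unitmx_tr -row_free_unit; apply: inj_row_free => v.
move=> /(congr1 trmx); rewrite trmx_mul trmxK trmx0 => /Ainj /(congr1 trmx).
by rewrite trmxK trmx0.
Qed.

(** * Barycentric coordinates *)

Section barycentric_coordinates.
Variables (R : realType) (n : nat).
Local Notation mu := (@lebesgue_colvec R n).
Implicit Types (P : 'I_n.+1 -> 'cV[R]_n) (x M : 'cV[R]_n) (l : 'I_n.+1 -> R).

(** Homogeneous coordinates: with a 1 on top of each vertex, the condition that the weights sum to 1
    and the vector equation form one square linear system. *)
Definition barycentric_mx P : 'M[R]_n.+1 := \matrix_(k, i) consv (1, P i) k ord0.

Lemma barycentric_mxP P x l :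
  is_barycentric P x l <-> barycentric_mx P *m (\col_i l i) = consv (1, x).
Proof.
split.
  move=> [l1 ->]; apply/colP => k; rewrite !mxE.
  case: (unliftP ord0 k) => [j|] -> /=.
    by rewrite summxE; apply: eq_bigr => i _ ; rewrite !mxE liftK mulrC.
  by rewrite -l1; apply: eq_bigr => i _; rewrite !mxE unlift_none mul1r.
move=> /colP h; split.
  have := h ord0; rewrite !mxE unlift_none /= => <-.
  by apply: eq_bigr => i _; rewrite !mxE unlift_none mul1r.
apply/colP => j; have := h (lift ord0 j); rewrite !mxE liftK /= => <-.
by rewrite summxE; apply: eq_bigr => i _ ; rewrite !mxE liftK mulrC.
Qed.

Lemma unit_barycentric_mx P : affinely_independent P -> barycentric_mx P \in unitmx.
Proof.
move=> aP; apply: unitmx_inj => c /colP h; apply/colP => i; rewrite mxE.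
apply: (aP (fun i => c i ord0)).
  have := h ord0; rewrite !mxE => h0; rewrite -[RHS]h0.
  by apply: eq_bigr => k _; rewrite !mxE unlift_none mul1r.
apply/colP => j; have := h (lift ord0 j); rewrite !mxE => hj; rewrite -[RHS]hj.
by rewrite summxE; apply: eq_bigr => k _; rewrite !mxE liftK mulrC.
Qed.

Section affinely_independent.
Variable P : 'I_n.+1 -> 'cV[R]_n.
Hypothesis aP : affinely_independent P.

Lemma barycentric_unique x l : is_barycentric P x l -> barycentric P x = l.
Proof.
move=> lx; rewrite /barycentric; case: xgetP => [l' -> /=|/(_ l)//].
move=> /barycentric_mxP h; move/barycentric_mxP : lx; rewrite -h.
move=> /(congr1 (mulmx (invmx (barycentric_mx P)))).
rewrite !mulKmx ?unit_barycentric_mx // => /colP e.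
by apply/funext => i; have := e i; rewrite !mxE.
Qed.

Lemma barycentricE x i :
  barycentric P x i = (invmx (barycentric_mx P) *m consv (1, x)) i ord0.
Proof.
rewrite (@barycentric_unique x (fun i => (invmx (barycentric_mx P) *m consv (1, x)) i ord0)) //.
apply/barycentric_mxP; rewrite -[RHS](mulKVmx (unit_barycentric_mx aP)).
by congr mulmx; apply/colP => j; rewrite mxE.
Qed.

Lemma is_barycentric_barycentric x : is_barycentric P x (barycentric P x).
Proof.
apply/barycentric_mxP; rewrite -[RHS](mulKVmx (unit_barycentric_mx aP)).
by congr mulmx; apply/colP => j; rewrite mxE barycentricE.
Qed.

Lemma sum_barycentric x : \sum_i barycentric P x i = 1.
Proof. by have [] := is_barycentric_barycentric x. Qed.

Lemma barycentricK x : \sum_i barycentric P x i *: P i = x.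
Proof. by have [] := is_barycentric_barycentric x. Qed.

Lemma barycentric_sum l : \sum_i l i = 1 -> barycentric P (\sum_i l i *: P i) = l.
Proof. by move=> l1; apply: barycentric_unique; split. Qed.

Lemma barycentric_vertex i : barycentric P (P i) = fun j => (j == i)%:R.
Proof.
apply: barycentric_unique; split.
  by rewrite (bigD1 i) //= eqxx big1 ?addr0 // => j /negPf ->.
rewrite (bigD1 i) //= eqxx scale1r big1 ?addr0 // => j /negPf ->.
by rewrite scale0r.
Qed.

Lemma barycentricDB x y z t i :
  barycentric P (x + t *: (y - z)) i =
  barycentric P x i + t * (barycentric P y i - barycentric P z i).
Proof.
rewrite (@barycentric_unique _ (fun i => barycentric P x i +
  t * (barycentric P y i - barycentric P z i))) //; split.
  by rewrite big_split /= -mulr_sumr sumrB !sum_barycentric subrr mulr0 addr0.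
rewrite -[in LHS](barycentricK x) -[in LHS](barycentricK y) -[in LHS](barycentricK z).
rewrite -sumrB scaler_sumr -big_split /=; apply: eq_bigr => j _.
by rewrite scalerDl -scalerBl scalerA.
Qed.

Lemma measurable_barycentric i : measurable_fun setT (barycentric P ^~ i).
Proof.
rewrite (_ : _ ^~ i = coorv i \o (fun x => invmx (barycentric_mx P) *m consv (1, x))).
  apply: measurableT_comp; first exact: measurable_coorv.
  apply: measurable_mulmxv; apply: measurableT_comp; first exact: measurable_consv.
  exact: measurable_pair1.
by apply/funext => x; rewrite barycentricE.
Qed.

Lemma simplexE : simplex P = [set x | forall i, 0 <= barycentric P x i].
Proof.
apply/seteqP; split => x /= => [[l [l0 l1 ->]] i|x0].
  by rewrite barycentric_sum.
exists (barycentric P x); split => //; first exact: sum_barycentric.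
by rewrite barycentricK.
Qed.

Lemma measurable_simplex : measurable (simplex P).
Proof.
rewrite simplexE (_ : [set x | _] = \bigcap_(i in [set: 'I_n.+1])
    ((barycentric P ^~ i) @^-1` `[0, +oo[%classic)).
  apply: fin_bigcap_measurable => [|i _]; first exact: finite_finset.
  by apply: measurable_preimage => //; exact: measurable_barycentric.
by apply/seteqP; split => x /= h i; have := h i; rewrite /= in_itv /= andbT //; exact.
Qed.

Lemma lebesgue_colvec_simplex_lty : (mu (simplex P) < +oo)%E.
Proof.
(* All weights are at most 1, so [r] bounds the absolute value of every entry of a convex
   combination. Hence the simplex lies in [A], the cube of side [r + r] centred at 0. *)
pose r : R := \sum_i \sum_j `|P i j ord0|.
have r0 : 0 <= r by apply: sumr_ge0 => i _; apply: sumr_ge0.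
pose A : set 'cV[R]_n := (fun x => x + const_mx r) @^-1` cube (r + r).
have mA : measurable A.
  apply: measurable_preimage; last exact: measurable_cube.
  by apply: measurable_addv => //; exact: measurable_id.
apply: (@le_lt_trans _ _ (mu A)).
  apply: le_measure; rewrite ?inE //; first exact: measurable_simplex.
  move=> x [l [l0 l1 ->]] j; rewrite !mxE summxE.
  suff: `|\sum_i (l i *: P i) j ord0| <= r.
    by rewrite ler_norml => /andP[h1 h2]; apply/andP; split; lra.
  apply: le_trans (ler_norm_sum _ _ _) _; apply: ler_sum => i _.
  have l1i : l i <= 1.
    by rewrite -l1 (bigD1 i) //= lerDl; apply: sumr_ge0 => k _.
  rewrite mxE normrM (ger0_norm (l0 i)) (bigD1 j) //=.
  apply: (@le_trans _ _ `|P i j ord0|); first by rewrite ler_piMl.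
  by rewrite lerDl; apply: sumr_ge0.
rewrite lebesgue_colvec_translate; last exact: measurable_cube.
by rewrite lebesgue_colvec_cube ?ltry // addr_ge0.
Qed.

Lemma volume_simplexE : (volume (simplex P))%:E = mu (simplex P).
Proof.
by rewrite fineK // ge0_fin_numE ?lebesgue_colvec_simplex_lty.
Qed.

Lemma volume_simplex_gt0 M : (simplex P)° M -> 0 < volume (simplex P).
Proof.
move=> /nbhs_ballP[e /= e0 eS].
have e20 : 0 < e / 2 by rewrite divr_gt0.
rewrite -lte_fin volume_simplexE.
(* Balls are those of the sup norm, so the closed cube with corner [M] and side [e / 2] fits in the
   open ball of radius [e]. *)
apply: (@lt_le_trans _ _ (mu ((fun x => x - M) @^-1` cube (e / 2)))).
  rewrite lebesgue_colvec_translate; last exact: measurable_cube.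
  by rewrite lebesgue_colvec_cube ?ltW // lte_fin exprn_gt0.
apply: le_measure; rewrite ?inE; last 2 first.
- exact: measurable_simplex.
- move=> x h; apply: eS; split => // i j; rewrite ord1.
  have := h i; rewrite !mxE /ball /= => /andP[h1 h2].
  rewrite distrC ger0_norm //; lra.
apply: measurable_preimage; last exact: measurable_cube.
by apply: measurable_addv => //; exact: measurable_id.
Qed.

End affinely_independent.
End barycentric_coordinates.

(** * Second moments of a simplex *)

Section affine_map.
Variables (R : realType) (n : nat).
Local Notation mu := (@lebesgue_colvec R n).
Implicit Types (P : 'I_n.+1 -> 'cV[R]_n) (x : 'cV[R]_n) (a b i : 'I_n.+1).

(** For affinely independent [P], the affine map that sends each [P i] to [P' i]. *)
Definition affine_map P P' x : 'cV[R]_n := \sum_i barycentric P x i *: P' i.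

Section two_simplexes.
Variables P P' : 'I_n.+1 -> 'cV[R]_n.
Hypotheses (aP : affinely_independent P) (aP' : affinely_independent P').

Lemma barycentric_affine_map x : barycentric P' (affine_map P P' x) = barycentric P x.
Proof. by rewrite barycentric_sum // sum_barycentric. Qed.

Lemma affine_map_mulmx : exists2 T : 'M[R]_n, T \in unitmx &
  forall x, affine_map P P' x = T *m x + affine_map P P' 0.
Proof.
pose B : 'M[R]_(n, n.+1) := \matrix_(j, i) P' i j ord0.
(* [L] puts a 0 on top of a vector; it is the linear part of the map that puts a 1 there. *)
pose L : 'M[R]_(n.+1, n) := \matrix_(k, j) (k == lift ord0 j)%:R.
have LE x : consv (1, x) = L *m x + consv (1, 0).
  apply/colP => k; rewrite !mxE; case: unliftP => [j|] -> /=.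
    rewrite mxE addr0 (bigD1 j) //= mxE eqxx mul1r big1 ?addr0 // => i ij.
    by rewrite mxE (inj_eq lift_inj) eq_sym (negPf ij) mul0r.
  by rewrite big1 ?add0r // => i _; rewrite mxE (negPf (neq_lift _ _)) mul0r.
have affE x : affine_map P P' x = B *m (invmx (barycentric_mx P) *m consv (1, x)).
  apply/colP => j; rewrite summxE mxE; apply: eq_bigr => i _.
  by rewrite mxE (barycentricE aP) [X in _ = X * _]mxE mulrC.
exists (B *m invmx (barycentric_mx P) *m L) => [|x].
  (* The linear part is injective because the map keeps barycentric coordinates, and these determine
     the point. *)
  apply: unitmx_inj => x xT0.
  have : affine_map P P' x = affine_map P P' 0.
    by rewrite !affE [in LHS]LE !mulmxDr !mulmxA xT0 add0r.
  move=> /(congr1 (barycentric P')); rewrite !barycentric_affine_map => e.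
  by rewrite -(barycentricK aP x) e barycentricK.
by rewrite !affE [in LHS]LE !mulmxDr !mulmxA.
Qed.

Lemma measurable_affine_map : measurable_fun setT (affine_map P P').
Proof.
have [T _ TE] := affine_map_mulmx.
rewrite (_ : affine_map P P' = fun x => T *m x + affine_map P P' 0); last exact/funext.
by apply: measurable_addv => //; apply: measurable_mulmxv; exact: measurable_id.
Qed.

Lemma lebesgue_colvec_preimage_affine_map : exists2 c : R, 0 < c &
  forall A, measurable A -> mu (affine_map P P' @^-1` A) = (c%:E * mu A)%E.
Proof.
have [T uT TE] := affine_map_mulmx.
have [c c0 cE] := lebesgue_colvec_preimage_mulmx uT.
exists c => // A mA; rewrite -(lebesgue_colvec_translate (affine_map P P' 0) mA) -cE.
  congr (lebesgue_colvec _).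
  by apply/seteqP; split => x /=; rewrite (TE x).
apply: measurable_preimage mA.
by apply: measurable_addv => //; exact: measurable_id.
Qed.

End two_simplexes.

(** Not divided by the volume, so that the integrals over the two halves of a simplex add up. *)
Definition moment P a b : R :=
  \int[mu]_(x in simplex P) (barycentric P x a * barycentric P x b).

(** * Moments and their behaviour under affine maps *)

Section moments.
Variable P : 'I_n.+1 -> 'cV[R]_n.
Hypothesis aP : affinely_independent P.

Lemma integrable_barycentricM a b :
  mu.-integrable (simplex P) (fun x => (barycentric P x a * barycentric P x b)%:E).
Proof.
apply: (@measurable_bounded_integrable _ _ _ mu (fun x => barycentric P x a * barycentric P x b)).
- exact: measurable_simplex.
- exact: lebesgue_colvec_simplex_lty.
- apply: (@measurable_funS _ _ _ _ setT) => //.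
  by apply: measurable_funM; exact: measurable_barycentric.
exists 1; split; first exact: num_real.
move=> K K1 x /=; rewrite (simplexE aP) /= => x0; apply: le_trans (ltW K1).
have le1 i : barycentric P x i <= 1.
  by rewrite -(sum_barycentric aP x) (bigD1 i) //= lerDl; apply: sumr_ge0.
by rewrite ger0_norm ?mulr_ge0 // mulr_ile1.
Qed.

Lemma Rintegral_barycentric_quadratic (c : 'I_n.+1 -> 'I_n.+1 -> R) :
  \int[mu]_(x in simplex P)
    (\sum_a \sum_b c a b * (barycentric P x a * barycentric P x b)) =
  \sum_a \sum_b c a b * moment P a b.
Proof.
have mS := measurable_simplex aP.
have iM a b : mu.-integrable (simplex P)
    (fun x => (c a b * (barycentric P x a * barycentric P x b))%:E).
  under eq_fun do rewrite EFinM.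
  by apply: integrableZl => //; exact: integrable_barycentricM.
apply: EFin_inj; rewrite /Rintegral fineK; last first.
  apply: integrable_fin_num => //.
  under eq_fun do rewrite -sumEFin.
  apply: integrable_sum => // a _.
  by under eq_fun do rewrite -sumEFin; apply: integrable_sum.
under eq_integral do rewrite -sumEFin.
rewrite integral_sum // => [|a]; last first.
  by under eq_fun do rewrite -sumEFin; apply: integrable_sum.
rewrite -sumEFin; apply: eq_bigr => a _.
under eq_integral do rewrite -sumEFin.
rewrite integral_sum // -sumEFin; apply: eq_bigr => b _.
have ib := integrable_barycentricM a b.
under eq_integral do rewrite EFinM.
by rewrite integralZl // EFinM fineK // integrable_fin_num.
Qed.

(** Integrate the square of the coordinate sum, which is constantly 1. This relation later
    normalizes the moments. *)
Lemma volume_simplex_moment : volume (simplex P) = \sum_a \sum_b moment P a b.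
Proof.
transitivity (\sum_a \sum_b 1 * moment P a b); last first.
  by apply: eq_bigr => a _; apply: eq_bigr => b _; rewrite mul1r.
rewrite -Rintegral_barycentric_quadratic -[LHS]mul1r.
have := Rintegral_cst mu (measurable_simplex aP) 1; rewrite -/(volume _) => <-.
apply: eq_Rintegral => x _.
transitivity ((\sum_a barycentric P x a) * \sum_b barycentric P x b).
  by rewrite sum_barycentric // mul1r.
rewrite mulr_suml; apply: eq_bigr => a _; rewrite mulr_sumr.
by apply: eq_bigr => b _; rewrite mul1r.
Qed.

End moments.

(** The affine map from [P] to [P'] preserves barycentric coordinates and pushes the measure forward
    to a constant multiple of itself. That constant does not depend on [a] and [b]. *)
Lemma moment_proportional P P' :
  affinely_independent P -> affinely_independent P' ->
  exists k : R, forall a b, moment P a b = k * moment P' a b.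
Proof.
move=> aP aP'; have [c c0 cE] := lebesgue_colvec_preimage_affine_map aP aP'.
exists c => a b.
have mphi := measurable_affine_map aP aP'.
pose g x := (barycentric P' x a * barycentric P' x b)%:E.
have mg : measurable_fun (simplex P') g.
  apply: (@measurable_funS _ _ _ _ setT) => //; apply/measurable_EFinP.
  by apply: measurable_funM; exact: measurable_barycentric.
have g0 : {in simplex P', forall y, (0 <= g y)%E}.
  by move=> y /set_mem; rewrite (simplexE aP') lee_fin => y0; rewrite mulr_ge0.
have mS' := measurable_simplex aP'.
transitivity (fine (\int[mu]_(x in affine_map P P' @^-1` simplex P')
    (g \o affine_map P P') x)).
  rewrite /moment (simplexE aP) (simplexE aP') /Rintegral.
  rewrite (_ : [set x | _] = affine_map P P' @^-1` [set x | forall i, 0 <= barycentric P' x i]).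
    by congr fine; apply: eq_integral => x _; rewrite /g /= barycentric_affine_map.
  by apply/seteqP; split => x /= h i; have := h i; rewrite barycentric_affine_map.
rewrite -(ge0_integral_pushforward mphi) //.
have -> : (\int[pushforward mu (affine_map P P')]_(x in simplex P') g x =
    \int[mscale (NngNum (ltW c0)) mu]_(x in simplex P') g x)%E.
  apply: (@eq_measure_integral _ _ _ _ (mscale (NngNum (ltW c0)) mu)
    (pushforward_measure mu mphi)) => A mA _; exact: cE.
rewrite ge0_integral_mscale // => [|x /mem_set]; last exact: g0.
rewrite fineM // integrable_fin_num //.
exact: integrable_barycentricM.
Qed.

(** The common factor [k] matters: comparing volumes determines it. *)
Lemma volume_moment_proportional P P' :
  affinely_independent P -> affinely_independent P' ->
  exists k : R, volume (simplex P) = k * volume (simplex P') /\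
    forall a b, moment P a b = k * moment P' a b.
Proof.
move=> aP aP'; have [k kE] := moment_proportional aP aP'; exists k; split => //.
rewrite !volume_simplex_moment // mulr_sumr; apply: eq_bigr => a _.
by rewrite mulr_sumr; apply: eq_bigr => b _.
Qed.

End affine_map.

(** * Cutting a simplex through the midpoint of an edge *)

Section bisection.
Variables (R : realType) (n : nat).
Local Notation mu := (@lebesgue_colvec R n).
Implicit Types (P : 'I_n.+1 -> 'cV[R]_n) (x : 'cV[R]_n) (a b i : 'I_n.+1).

Lemma sum_delta (V : lmodType R) a (f : 'I_n.+1 -> V) :
  \sum_i (i == a)%:R *: f i = f a.
Proof.
rewrite (bigD1 a) //= eqxx scale1r big1 ?addr0 // => i /negPf ->.
by rewrite scale0r.
Qed.

Lemma sum_deltaB a b : \sum_i ((i == a)%:R - (i == b)%:R) = 0 :> R.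
Proof.
have E c : \sum_(i < n.+1) (i == c)%:R = 1 :> R.
  by rewrite (bigD1 c) //= eqxx big1 ?addr0 // => i /negPf ->.
by rewrite sumrB !E subrr.
Qed.

(** The vertex [P a] is replaced by the midpoint of the edge from [P a] to [P b], which gives the
    half that contains [P b]. The Kronecker delta keeps sums over vertices free of case
    distinctions. *)
Definition bisect P a b i : 'cV[R]_n := P i + (i == a)%:R *: (2^-1 *: (P b - P a)).

Lemma sum_bisect P a b (l : 'I_n.+1 -> R) :
  \sum_i l i *: bisect P a b i =
  \sum_i (l i + l a / 2 * ((i == b)%:R - (i == a)%:R)) *: P i.
Proof.
have bisectE i : l i *: bisect P a b i =
    l i *: P i + (i == a)%:R *: (l i *: (2^-1 *: (P b - P a))).
  by rewrite /bisect scalerDr !scalerA; congr (_ + _ *: _); ring.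
under eq_bigr => i _ do rewrite bisectE.
rewrite big_split /=.
have /= -> := sum_delta a (fun i => l i *: (2^-1 *: (P b - P a))).
under [RHS]eq_bigr => i _ do rewrite scalerDl -scalerA scalerBl.
rewrite [RHS]big_split /= -scaler_sumr sumrB !sum_delta; congr (_ + _).
by rewrite scalerA.
Qed.

Section one_edge.
Variables (P : 'I_n.+1 -> 'cV[R]_n) (a b : 'I_n.+1).
Hypotheses (aP : affinely_independent P) (ab : a != b).

Lemma affinely_independent_bisect : affinely_independent (bisect P a b).
Proof.
move=> c c0; rewrite sum_bisect => /aP h.
have {}h i : c i + c a / 2 * ((i == b)%:R - (i == a)%:R) = 0.
  by apply: h; rewrite big_split /= c0 -mulr_sumr sum_deltaB mulr0 addr0.
have ca : c a = 0 by have := h a; rewrite eqxx (negPf ab) /=; lra.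
by move=> i; have := h i; rewrite ca !mul0r addr0.
Qed.

(** The midpoint must supply the whole weight of [P a], so it gets twice that weight, and the same
    amount is then taken off [P b]. *)
Lemma barycentric_bisect x : barycentric (bisect P a b) x =
  fun i => barycentric P x i + barycentric P x a * ((i == a)%:R - (i == b)%:R).
Proof.
apply: barycentric_unique; first exact: affinely_independent_bisect.
split; first by rewrite big_split /= -mulr_sumr sum_deltaB mulr0 addr0 sum_barycentric.
rewrite sum_bisect eqxx (negPf ab) /= -[in LHS](barycentricK aP x).
by apply: eq_bigr => i _; congr (_ *: _); lra.
Qed.

Lemma simplex_bisect : simplex (bisect P a b) =
  simplex P `&` [set x | barycentric P x a <= barycentric P x b].
Proof.
rewrite (simplexE aP) (simplexE affinely_independent_bisect).
apply/seteqP; split => x /=; rewrite barycentric_bisect.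
  move=> h; have := h a; have := h b.
  rewrite !eqxx (negPf ab) eq_sym (negPf ab) /= => hb ha; split; last by lra.
  move=> i; have := h i; have [->|ia] := eqVneq i a; first by lra.
  have [->|ib] := eqVneq i b; first by lra.
  by rewrite subrr mulr0 addr0.
move=> [h hab] i; have := h i; have := h a; have [->|ia] := eqVneq i a.
  by rewrite (negPf ab) /=; lra.
by have [->|ib] := eqVneq i b => /=; lra.
Qed.

Lemma null_bisector : mu [set x | barycentric P x a = barycentric P x b] = 0%E.
Proof.
rewrite (_ : [set x | _] = [set x | barycentric P x a - barycentric P x b = 0]); last first.
  by apply/seteqP; split => x /= => [->|/subr0_eq //]; rewrite subrr.
(* Moving by [t] times this vector raises coordinate [a] by [t / 2] and lowers coordinate [b] by as
   much, so their difference grows by [t]. *)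
apply: (@lebesgue_colvec_level0 _ _ _ (2^-1 *: (P a - P b))).
  by apply: measurable_funB; exact: measurable_barycentric.
move=> x t; rewrite scalerA !barycentricDB // !barycentric_vertex //.
by rewrite !eqxx (negPf ab) eq_sym (negPf ab) /=; lra.
Qed.

End one_edge.

Lemma Rintegral_bisect P a b (f : 'cV[R]_n -> R) :
  affinely_independent P -> a != b -> mu.-integrable (simplex P) (EFin \o f) ->
  \int[mu]_(x in simplex P) f x =
  \int[mu]_(x in simplex (bisect P a b)) f x +
  \int[mu]_(x in simplex (bisect P b a)) f x.
Proof.
move=> aP ab iF; have ba : b != a by rewrite eq_sym.
have mA := measurable_simplex (affinely_independent_bisect aP ab).
have mB := measurable_simplex (affinely_independent_bisect aP ba).
pose N := [set x | barycentric P x a = barycentric P x b].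
have mN : measurable N.
  rewrite (_ : N = (fun x => barycentric P x a - barycentric P x b) @^-1` [set 0]).
    apply: measurable_preimage; last exact: measurable_set1.
    by apply: measurable_funB; exact: measurable_barycentric.
  by apply/seteqP; split => x /= => [->|/subr0_eq //]; rewrite subrr.
(* The halves share points of the bisector [N]. Removing it from one half makes the union disjoint
   and costs nothing, as [N] is null. *)
have SE : simplex P = (simplex (bisect P a b) `\` N) `|` simplex (bisect P b a).
  rewrite !simplex_bisect //; apply/seteqP; split => x /=; last by case => [[[]]|[]].
  move=> Sx; have [l|l|e] := ltgtP (barycentric P x a) (barycentric P x b).
  - by left; split; [split; rewrite // ltW|move=> e; move: l; rewrite e ltxx].
  - by right; split => //; rewrite ltW.
  - by right; split => //; rewrite e.
rewrite [in LHS]SE Rintegral_setU //; last 3 first.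
- exact: measurableD.
- by rewrite -SE.
- apply/disj_setPS => x [[+ +] +]; rewrite !simplex_bisect // => -[_ /= h1] h2 [_ /= h3].
  by apply: h2; apply: le_anti; rewrite h1.
congr (_ + _); rewrite /Rintegral; congr fine; symmetry.
apply: negligible_integral => //; last exact: null_bisector.
apply: integrableS iF => //; first exact: measurable_simplex.
by rewrite simplex_bisect //; exact: subIsetl.
Qed.

(** In terms of the coordinates m of the half at hand, coordinate [a] of [P] is m_a / 2 on the first
    half and m_a + m_b / 2 on the second. Square and integrate. *)
Lemma moment_diag_bisect P a b : affinely_independent P -> a != b ->
  moment P a a = 4^-1 * moment (bisect P a b) a a +
    (moment (bisect P b a) a a + moment (bisect P b a) a b +
     4^-1 * moment (bisect P b a) b b).
Proof.
move=> aP ab; have ba : b != a by rewrite eq_sym.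
rewrite [LHS](Rintegral_bisect aP ab (integrable_barycentricM aP a a)).
have aA := affinely_independent_bisect aP ab.
have aB := affinely_independent_bisect aP ba.
have mA := measurable_simplex aA.
have mB := measurable_simplex aB.
have iB := integrable_barycentricM aB.
congr (_ + _).
  rewrite -RintegralZl //; last exact: integrable_barycentricM.
  apply: eq_Rintegral => x _; rewrite barycentric_bisect // !eqxx (negPf ab) /=; lra.
have iaab : mu.-integrable (simplex (bisect P b a)) (EFin \o (fun x =>
    barycentric (bisect P b a) x a * barycentric (bisect P b a) x a +
    barycentric (bisect P b a) x a * barycentric (bisect P b a) x b)).
  exact: integrableD (iB a a) (iB a b).
have ibb : mu.-integrable (simplex (bisect P b a)) (EFin \o (fun x =>
    4^-1 * (barycentric (bisect P b a) x b * barycentric (bisect P b a) x b))).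
  exact: integrableZl (iB b b).
rewrite /moment -RintegralZl; [|exact: mB|exact: iB].
rewrite -RintegralD; [|exact: mB|exact: iB|exact: iB].
rewrite -RintegralD; [|exact: mB|exact: iaab|exact: ibb].
apply: eq_Rintegral => x _; rewrite barycentric_bisect // !eqxx (negPf ab) (negPf ba) /=; lra.
Qed.

Lemma volume_bisect P a b : affinely_independent P -> a != b ->
  volume (simplex P) = volume (simplex (bisect P a b)) + volume (simplex (bisect P b a)).
Proof.
move=> aP ab; have ba : b != a by rewrite eq_sym.
have volE (Q : 'I_n.+1 -> 'cV[R]_n) : affinely_independent Q ->
    volume (simplex Q) = \int[mu]_(x in simplex Q) 1.
  by move=> aQ; rewrite Rintegral_cst ?mul1r //; exact: measurable_simplex.
rewrite !volE //; try exact: affinely_independent_bisect.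
apply: Rintegral_bisect => //.
have mS := measurable_simplex aP.
apply: measurable_bounded_integrable => //; first exact: lebesgue_colvec_simplex_lty.
exists 1; split; first exact: num_real.
by move=> K K1 x _; rewrite normr1 ltW.
Qed.

Lemma simplex_perm P (s : {perm 'I_n.+1}) : simplex (P \o s) = simplex P.
Proof.
have sub (Q : 'I_n.+1 -> 'cV[R]_n) (t : {perm 'I_n.+1}) : simplex Q `<=` simplex (Q \o t).
  move=> x [l [l0 l1 ->]]; exists (l \o t); split => [i||]; first exact: l0.
    by rewrite -l1 [RHS](reindex_inj (@perm_inj _ t)).
  by rewrite (reindex_inj (@perm_inj _ t)).
apply/seteqP; split; last exact: sub.
rewrite [X in _ `<=` simplex X](_ : P = (P \o s) \o (s^-1)%g); first exact: sub.
by apply/funext => i /=; rewrite permKV.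
Qed.

Lemma affinely_independent_perm P (s : {perm 'I_n.+1}) :
  affinely_independent P -> affinely_independent (P \o s).
Proof.
move=> aP c c0 cP i; rewrite -(permK s i).
apply: (aP (c \o (s^-1)%g)).
  by rewrite -[RHS]c0 (reindex_inj (@perm_inj _ s)); apply: eq_bigr => j _ /=; rewrite permK.
by rewrite -[RHS]cP (reindex_inj (@perm_inj _ s)); apply: eq_bigr => j _ /=; rewrite permK.
Qed.

(** Renumbering the vertices leaves the simplex unchanged, so the proportionality factor between the
    two moment families is 1 by comparison of the nonzero volumes. *)
Lemma moment_perm P (s : {perm 'I_n.+1}) a b : affinely_independent P ->
  volume (simplex P) != 0 -> moment P (s a) (s b) = moment P a b.
Proof.
move=> aP V0; have aPs := affinely_independent_perm (s := s) aP.
have [k [kV kE]] := volume_moment_proportional aPs aP.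
have k1 : k = 1.
  by move: kV; rewrite simplex_perm => /esym/(canRL (mulfK V0)) ->; rewrite divff.
rewrite -[RHS]mul1r -k1 -kE /moment simplex_perm; apply: eq_Rintegral => x _.
rewrite (@barycentric_unique _ _ _ aPs x (barycentric P x \o s)) //; split.
  by rewrite -(sum_barycentric aP x) [RHS](reindex_inj (@perm_inj _ s)).
by rewrite -[LHS](barycentricK aP x) (reindex_inj (@perm_inj _ s)).
Qed.

Lemma momentC P a b : moment P a b = moment P b a.
Proof. by apply: eq_Rintegral => x _; rewrite mulrC. Qed.

(* Write p, q for the diagonal and off-diagonal moments. The two halves cut off
   by a median hyperplane carry k' and k'' times the moments of [P], where
   k' + k'' = 1, whence 2 p = p / 4 + (p + q + p / 4). *)
Lemma moment_off_diag P a b : affinely_independent P ->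
  volume (simplex P) != 0 -> a != b -> moment P a b = moment P a a / 2.
Proof.
move=> aP V0 ab; have ba : b != a by rewrite eq_sym.
have pE : moment P b b = moment P a a.
  by rewrite -(moment_perm (tperm a b) a a aP V0) tpermL.
have [k1 [kV1 kE1]] := volume_moment_proportional (affinely_independent_bisect aP ab) aP.
have [k2 [kV2 kE2]] := volume_moment_proportional (affinely_independent_bisect aP ba) aP.
have k12 : k1 + k2 = 1.
  by apply: (mulIf V0); rewrite mulrDl mul1r -kV1 -kV2 -volume_bisect.
have := moment_diag_bisect aP ab; have := moment_diag_bisect aP ba.
rewrite !kE1 !kE2 pE (momentC P b a).
have -> : k2 = 1 - k1 by lra.
by lra.
Qed.

(** By symmetry all diagonal moments equal some p, and the others equal p / 2. Each row then sums to
    (p / 2) (n + 2), and the total over n + 1 rows is the volume, which determines p. *)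
Lemma moment_simplex P a b : affinely_independent P -> volume (simplex P) != 0 ->
  moment P a b = volume (simplex P) / (n.+1%:R * n.+2%:R) * (1 + (a == b)%:R).
Proof.
move=> aP V0; pose p := moment P ord0 ord0.
have pE i : moment P i i = p.
  by rewrite /p -(moment_perm (tperm ord0 i) ord0 ord0 aP V0) tpermL.
have mE i j : moment P i j = p / 2 * (1 + (i == j)%:R).
  have [->|ij] := eqVneq i j; first by rewrite pE /=; lra.
  by rewrite moment_off_diag // pE addr0 mulr1.
have VE : volume (simplex P) = p / 2 * (n.+1%:R * n.+2%:R).
  rewrite volume_simplex_moment //.
  have -> : p / 2 * (n.+1%:R * n.+2%:R) = \sum_(i < n.+1) p / 2 * n.+2%:R.
    by rewrite sumr_const card_ord -mulr_natr; field.
  apply: eq_bigr => i _; under eq_bigr => j _ do rewrite mE.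
  rewrite -mulr_sumr big_split /= sumr_const card_ord (bigD1 i) //= eqxx big1 => [|j].
    by rewrite addr0 -[n.+2]addn1 natrD.
  by rewrite eq_sym => /negPf ->.
by rewrite mE VE mulfK // mulf_neq0 // pnatr_eq0.
Qed.

End bisection.

(** * Covariance matrix and corner simplexes *)

Section covariance.
Variables (R : realType) (n : nat) (P : 'I_n.+1 -> 'cV[R]_n).
Hypothesis aP : affinely_independent P.
Local Notation G := (centroid P).

Definition centered_mx : 'M[R]_(n, n.+1) := \matrix_(j, i) (P i - G) j ord0.
Local Notation D := centered_mx.

Lemma centered_mx_sum j : \sum_i D j i = 0.
Proof.
under eq_bigr => i _ do rewrite !mxE.
by rewrite sumrB sumr_const card_ord summxE -mulrnAl -mulr_natr mulVf ?mul1r ?subrr.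
Qed.

Lemma centered_mx_mul (c : 'I_n.+1 -> R) :
  D *m (\col_i c i) = \sum_i c i *: P i - (\sum_i c i) *: G.
Proof.
apply/colP => j; rewrite !mxE summxE mulr_suml -sumrB; apply: eq_bigr => i _.
by rewrite !mxE mulrC mulrBr.
Qed.

Lemma centered_mx_barycentric x : D *m (\col_i barycentric P x i) = x - G.
Proof. by rewrite centered_mx_mul barycentricK // sum_barycentric // scale1r. Qed.

(** For weights of sum 0 the centroid drops out of the product, and what remains is affine
    independence. *)
Lemma centered_mx_inj (c : 'cV[R]_n.+1) :
  \sum_i c i ord0 = 0 -> D *m c = 0 -> c = 0.
Proof.
move=> c0; rewrite [c in D *m c](_ : c = \col_i c i ord0); last first.
  by apply/colP => i; rewrite mxE.
rewrite centered_mx_mul c0 scale0r subr0 => /(aP c0) h.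
by apply/colP => i; rewrite h mxE.
Qed.

Lemma sum_trmx_centered (y : 'cV[R]_n) : \sum_i (D^T *m y) i ord0 = 0.
Proof.
under eq_bigr => i _ do rewrite mxE.
rewrite exchange_big big1 // => j _.
under eq_bigr => i _ do rewrite [_^T _ _]mxE.
by rewrite -mulr_suml centered_mx_sum mul0r.
Qed.

(** If D D^T y = 0 then D^T y = 0, since D^T y has sum 0. Writing y = D u, with u the coordinates of
    y + G, gives y^T y = u^T D^T y = 0. *)
Lemma unit_centered_gram : D *m D^T \in unitmx.
Proof.
apply: unitmx_inj => y; rewrite -mulmxA => /(centered_mx_inj (sum_trmx_centered y)) Dy0.
have yE : D *m (\col_i barycentric P (y + G) i) = y by rewrite centered_mx_barycentric addrK.
have /matrixP/(_ ord0 ord0) : y^T *m y = 0.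
  by rewrite -[in y^T]yE trmx_mul -mulmxA Dy0 mulmx0.
rewrite !mxE => yy0; apply/colP => j; rewrite mxE; apply/eqP; rewrite -sqrf_eq0.
have /psumr_eq0P : \sum_j y j ord0 ^+ 2 = 0.
  by rewrite -[RHS]yy0; apply: eq_bigr => k _; rewrite mxE expr2.
by move=> ->// k _; exact: sqr_ge0.
Qed.

Lemma covariance_mxE : volume (simplex P) != 0 ->
  covariance_mx P = (n.+1%:R * n.+2%:R)^-1 *: (D *m D^T).
Proof.
move=> V0; apply/matrixP => j k; rewrite !mxE.
transitivity ((volume (simplex P))^-1 *
    \sum_a \sum_b D j a * D k b * moment P a b).
  congr (_ * _); rewrite -Rintegral_barycentric_quadratic //.
  apply: eq_Rintegral => x _; rewrite -centered_mx_barycentric mxE big_ord1.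
  rewrite [_^T _ _]mxE !mxE mulr_suml; apply: eq_bigr => a _.
  by rewrite mulr_sumr; apply: eq_bigr => b _; rewrite !mxE; ring.
rewrite !mulr_sumr; apply: eq_bigr => a _; rewrite [_^T _ _]mxE.
transitivity ((n.+1%:R * n.+2%:R)^-1 * (D j a * \sum_b D k b * (1 + (a == b)%:R))).
  rewrite !mulr_sumr; apply: eq_bigr => b _; rewrite moment_simplex //.
  by field; rewrite V0 nat1r -natrD !pnatr_eq0.
congr (_ * (_ * _)).
(* The constant part of the moments contributes a row sum of [D], which is 0; only the diagonal part
   survives. *)
under eq_bigr => b _ do rewrite mulrDr mulr1.
rewrite big_split /= centered_mx_sum add0r (bigD1 a) //= eqxx mulr1 big1 ?addr0 // => b.
by rewrite eq_sym => /negPf ->; rewrite mulr0.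
Qed.

(** The inverse is never computed. With z the column of [w] and y = C^-1 D z, the formula for C
    gives D D^T y = q D z. Both D^T y and q z have sum 0, so D^T y = q z, and the form equals z^T
    D^T y = q z^T z. *)
Lemma covariance_mx_quadratic (w : 'I_n.+1 -> R) :
  volume (simplex P) != 0 -> \sum_i w i = 0 ->
  ((D *m (\col_i w i))^T *m invmx (covariance_mx P) *m (D *m (\col_i w i))) ord0 ord0 =
  (n.+1%:R * n.+2%:R) * \sum_i w i ^+ 2.
Proof.
move=> V0 w0; set q : R := n.+1%:R * n.+2%:R.
have q0 : q != 0 by rewrite mulf_neq0 // pnatr_eq0.
have uC : covariance_mx P \in unitmx.
  by rewrite covariance_mxE // unitmxZ ?unit_centered_gram // unitfE invr_eq0.
set z := \col_i w i; set y := invmx (covariance_mx P) *m (D *m z).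
have zE : D^T *m y = q *: z.
  apply: subr0_eq; apply: centered_mx_inj.
    have subE i : (D^T *m y - q *: z) i ord0 = (D^T *m y) i ord0 - q * w i.
      by rewrite !mxE.
    under eq_bigr => i _ do rewrite subE.
    by rewrite sumrB sum_trmx_centered -mulr_sumr w0 mulr0 subr0.
  have : covariance_mx P *m y = D *m z by rewrite mulKVmx.
  rewrite covariance_mxE // -scalemxAl -mulmxA => /(congr1 (fun u => q *: u)).
  rewrite scalerA divff // scale1r => e.
  by rewrite mulmxBr e scalemxAr subrr.
rewrite -mulmxA -/y trmx_mul -mulmxA zE -scalemxAr mxE; congr (_ * _).
by rewrite mxE; apply: eq_bigr => i _; rewrite !mxE expr2.
Qed.

End covariance.

(** * Volumes of corner simplexes and the final computation *)

Section corners.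
Variables (R : realType) (n : nat) (P : 'I_n.+1 -> 'cV[R]_n).
Hypothesis aP : affinely_independent P.
Local Notation mu := (@lebesgue_colvec R n).

Lemma volume_homothetic_simplex M i (r : R) : (0 < n)%N -> 0 <= r ->
  volume [set M + r *: (x - P i) | x in simplex P] = r ^+ n * volume (simplex P).
Proof.
(* For [r = 0] the set is the single point [M], a translated cube of side 0, which is null because
   [n] is positive. *)
move=> n0; rewrite le_eqVlt => /predU1P[<-|r0].
  rewrite expr0n gtn_eqF // mul0r.
  have -> : [set M + 0 *: (x - P i) | x in simplex P] = (fun x => x - M) @^-1` cube 0.
    apply/seteqP; split => x /=.
      by move=> [z _ <-] j; rewrite scale0r addr0 subrr mxE lexx.
    move=> h; exists (P i).
      by rewrite (simplexE aP) => j; rewrite /= barycentric_vertex.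
    rewrite scale0r addr0; apply: esym; apply: subr0_eq; apply/colP => j.
    by have := h j; rewrite [RHS]mxE => h'; apply: le_anti; rewrite andbC.
  rewrite /volume lebesgue_colvec_translate; last exact: measurable_cube.
  by rewrite lebesgue_colvec_cube // expr0n gtn_eqF.
set A := [set _ | _ in _].
have rn0 : r != 0 by rewrite gt_eqF.
(* Solving r y = M + r (x - P_i) for x gives x = y + v. *)
pose v := P i - r^-1 *: M.
have AE y : A (r *: y) <-> simplex P (y + v).
  split => [[x Sx e]|Sy].
    rewrite /v (_ : y + _ = x) //.
    rewrite -[y](scalerK rn0) -e scalerDr scalerA mulVf // scale1r.
    by rewrite addrC addrA subrK addrC subrK.
  exists (y + v) => //; rewrite /v addrA addrAC addrK scalerBr scalerA divff // scale1r.
  by rewrite addrC subrK.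
have mA : measurable A.
  have -> : A = (fun x => r^-1%:M *m x + v) @^-1` simplex P.
    apply/seteqP; split => x /=.
      by rewrite mul_scalar_mx -{1}[x](scalerKV rn0) => /AE.
    by rewrite mul_scalar_mx -{2}[x](scalerKV rn0) => /AE.
  apply: measurable_preimage; last exact: measurable_simplex.
  by apply: measurable_addv => //; apply: measurable_mulmxv; exact: measurable_id.
have muA : mu A = ((r ^+ n)%:E * mu (simplex P))%E.
  rewrite (lebesgue_colvec_scale r0 mA); congr (_ * _)%E.
  rewrite -(lebesgue_colvec_translate v (measurable_simplex aP)).
  by congr (lebesgue_colvec _); apply/seteqP; split => y /AE.
by rewrite /volume muA fineM // ge0_fin_numE ?lebesgue_colvec_simplex_lty.
Qed.

End corners.

Theorem proposition2 (R : realType) (n : nat) (n_ge1 : (1 <= n)%N)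
    (P : 'I_n.+1 -> 'cV[R]_n) (P_indep : affinely_independent P)
    (M : 'cV[R]_n) (M_interior : (simplex P)° M) :
  \sum_(i < n.+1)
      (volume (corner_simplex P M i) / volume (simplex P)) `^ (2 / n%:R) =
  n.+1%:R^-1 +
  (n.+1%:R * n.+2%:R)^-1 *
    ((M - centroid P)^T *m invmx (covariance_mx P) *m (M - centroid P))
      ord0 ord0.
Proof.
have V0 : volume (simplex P) != 0 by rewrite gt_eqF // (volume_simplex_gt0 P_indep M_interior).
have l0 i : 0 <= barycentric P M i.
  by have := interior_subset M_interior; rewrite (simplexE P_indep); exact.
transitivity (\sum_i barycentric P M i ^+ 2).
  apply: eq_bigr => i _; rewrite volume_homothetic_simplex // mulfK //.
  (* The volume ratio is the [n]-th power of a nonnegative coordinate, so the exponent [2 / n] turns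
     it into the square. *)
  by rewrite -powR_mulrn // -powRrM mulrC divfK ?pnatr_eq0 -?lt0n // powR_mulrn.
(* [c] is every barycentric coordinate of the centroid, so [w] represents [M - centroid P] with
   weights of sum 0. *)
pose c : R := n.+1%:R^-1; pose w i := barycentric P M i - c.
have nc : n.+1%:R * c = 1 by rewrite divff // pnatr_eq0.
have w0 : \sum_i w i = 0.
  by rewrite sumrB sum_barycentric // sumr_const card_ord -mulr_natl nc subrr.
have <- : centered_mx P *m (\col_i w i) = M - centroid P.
  rewrite centered_mx_mul w0 scale0r subr0.
  under eq_bigr => i _ do rewrite scalerBl.
  by rewrite sumrB barycentricK // -scaler_sumr.
rewrite covariance_mx_quadratic // mulKf ?mulf_neq0 ?pnatr_eq0 //.
(* Since the coordinates sum to 1 and (n + 1) c = 1, the squares of [w] sum to the sum of the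
   squared coordinates minus 2 c plus c; the leading term c compensates. *)
rewrite /w -/c; under [in RHS]eq_bigr => i _ do rewrite sqrrB.
rewrite big_split /= sumrB sumr_const card_ord.
rewrite sumrMnl -mulr_suml sum_barycentric // mul1r -[c ^+ 2 *+ _]mulr_natl.
by rewrite expr2 mulrA nc; ring.
Qed.
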